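(* There exists a topological dynamical system $(X,f)$ ($X$ a compact metric space, $f:X\to X$ continuous) such that for any $0\alpha_2\alpha_3\alpha_401\in\mathfrak A$ and any $\beta_1\beta_2\beta_3\beta_4\beta_50\in\mathfrak A$ there always exist a point of $X$ satisfying Case $(0\alpha_2\alpha_3\alpha_401)$ and a point of $X$ satisfying Case $(\beta_1\beta_2\beta_3\beta_4\beta_50)$.
   Context: For a topological dynamical system $(X,f)$ with metric $d$ on $X$ and $x\in X$: $\operatorname{orb}(x,f)=\{f^n(x)\}_{n\ge0}$, $\omega_f(x)=\bigcap_{n\ge1}\overline{\bigcup_{k\ge n}\{f^k(x)\}}$, $B(y,\varepsilon)$ is the open ball, $N(x,U)=\{n\ge0:f^n(x)\in U\}$. Densities of a set $S$ of nonnegative integers: $\overline d(S)=\limsup_{n\to\infty}\frac{|S\cap\{0,\dots,n-1\}|}{n}$, $\underline d(S)=\liminf_{n\to\infty}\frac{|S\cap\{0,\dots,n-1\}|}{n}$, $\overline B(S)=\limsup_{|I|\to\infty}\frac{|S\cap I|}{|I|}$, $\underline B(S)=\liminf_{|I|\to\infty}\frac{|S\cap I|}{|I|}$, with $I$ ranging over finite intervals of consecutive integers. For $\xi\in\{\overline d,\underline d,\overline B,\underline B\}$, $\omega_\xi(x)=\{y\in X:\xi(N(x,B(y,\varepsilon)))>0\text{ for every }\varepsilon>0\}$. One always has $\emptyset\subseteq\omega_{\underline B}(x)\subseteq\omega_{\underline d}(x)\subseteq\omega_{\overline d}(x)\subseteq\omega_{\overline B}(x)\subseteq\omega_f(x)\subseteq\overline{\operatorname{orb}(x,f)}$.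 For $\alpha_1\alpha_2\cdots\alpha_6\in\{0,1\}^6$, $x$ satisfies Case $(\alpha_1\cdots\alpha_6)$ if $$\emptyset\star_1\omega_{\underline B}(x)\star_2\omega_{\underline d}(x)\star_3\omega_{\overline d}(x)\star_4\omega_{\overline B}(x)\star_5\omega_f(x)\star_6\overline{\operatorname{orb}(x,f)},$$ where $\star_i$ is $\subsetneq$ if $\alpha_i=0$ and $=$ if $\alpha_i=1$. $\mathfrak A=\{0,1\}^6\setminus\{111\alpha_4\alpha_5\alpha_6:\alpha_4\alpha_5\alpha_6\in\{0,1\}^3\}$. *)

(* Defs.v *)
From mathcomp Require Import all_boot all_order all_algebra.
From mathcomp Require Import all_classical all_reals all_analysis.

Set Implicit Arguments.
Unset Strict Implicit.
Unset Printing Implicit Defensive.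

Import Order.TTheory GRing.Theory Num.Theory.
Local Open Scope classical_set_scope.
Local Open Scope ring_scope.

Section Densities.
Variable R : realType.
Implicit Type S : set nat.

(* A pair [I = (m, n)] encodes the interval {m, ..., m + n - 1} of n
   consecutive nonnegative integers.  The value at n = 0 is 0 by the
   convention x / 0 = 0 and is irrelevant to all the limits below. *)
Definition frequency S (I : nat * nat) : \bar R :=
  ((count (fun k => k \in S) (iota I.1 I.2))%:R / I.2%:R)%:E.

(* The filter |I| --> oo on intervals, uniformly in their left endpoints. *)
Definition long_intervals : set_system (nat * nat) :=
  filter_from [set: nat] (fun N => [set I | (N <= I.2)%N]).

Definition upper_density S : \bar R :=
  limn_esup (fun n => frequency S (0%N, n)).
Definition lower_density S : \bar R :=
  limn_einf (fun n => frequency S (0%N, n)).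
Definition upper_Banach_density S : \bar R :=
  limf_esup (frequency S) long_intervals.
Definition lower_Banach_density S : \bar R :=
  limf_einf (frequency S) long_intervals.

End Densities.

Section Dynamics.
Variables (R : realType) (X : metricType R) (f : X -> X).
Implicit Type x : X.

Definition orb x : set X := [set iter n f x | n in [set: nat]].

Definition omega_limit x : set X :=
  \bigcap_(n in [set n | (1 <= n)%N])
    closure (\bigcup_(k in [set k | (n <= k)%N]) [set iter k f x]).

Definition visit_times x (U : set X) : set nat := [set n | U (iter n f x)].

Definition omega_density (xi : set nat -> \bar R) x : set X :=
  [set y | forall e : R, 0 < e -> (0 < xi (visit_times x (ball y e)))%E].

Definition omega_chain x : seq (set X) :=
  [:: set0; omega_density (@lower_Banach_density R) x;
      omega_density (@lower_density R) x; omega_density (@upper_density R) x;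
      omega_density (@upper_Banach_density R) x; omega_limit x;
      closure (orb x)].

(* Digits of a code: [false] is 0 (strict inclusion), [true] is 1 (equality);
   the digit of index i (from 0) compares the sets of index i and i + 1. *)
Definition chain_step (digit : bool) (A B : set X) : Prop :=
  if digit then A = B else A `<` B.

Definition satisfies_case (alpha : 6.-tuple bool) x : Prop :=
  forall i : 'I_6, chain_step (tnth alpha i)
    (nth set0 (omega_chain x) i) (nth set0 (omega_chain x) i.+1).

End Dynamics.

Definition admissible_codes : set (6.-tuple bool) :=
  [set: 6.-tuple bool] `\`
  [set alpha | exists a4 a5 a6 : bool,
     alpha = [tuple true; true; true; a4; a5; a6]].

(* Main.v *)
Require Import Defs.
From HB Require Import structures.
From mathcomp Require Import all_boot all_order all_algebra zify.
From mathcomp Require Import all_classical all_reals all_analysis.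

(* All codes are realized in the full shift on seven letters, where omega_xi(x)
   consists of the sequences all of whose prefixes occur in x with positive
   density xi.  Every strict inclusion gets a letter of its own: x is built so
   that a letter of class c occurs with positive density of type c but not of
   type c - 1, while every word over the letters of class at most c occurs with
   positive density of type c.  The filler letter 0 has the class of the first
   strict inclusion, which is at most 3 because the code is admissible; letter 6
   occurs at time 0 only and separates the orbit closure from the omega-limit
   set.

   The times n are sorted by their leading base 8 digits.  Periodic words fill
   a fixed proportion of each [8^s, 8^(s+1)) (lower density), most of
   super-exponentially long epochs (upper density), or just [8^s, 8^s + s)
   (upper Banach density), each word being used infinitely often.

   Two cases need more care.  When omega is nonempty for the lower Banach
   density it lies in every minimal subset of omega_f(x), so that all words must
   contain long runs of 0 syndetically: these are imposed at the times in [gap].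
   A letter of class 5 has upper Banach density 0, so 5^infinity must be kept
   out of omega_f(x): that letter is confined to the set [sparse] of times with
   base 8 digits 0 and 1, of Banach density 0 but stable under the translations
   by large powers of 8, which preserves recurrence. *)

Set Implicit Arguments.
Unset Strict Implicit.
Unset Printing Implicit Defensive.

(** * Counting in intervals of integers *)

Lemma count_iota_shift (P : pred nat) i m n :
  count (fun k => P (k + i)) (iota m n) = count P (iota (m + i) n).
Proof. by rewrite addnC iotaDl count_map; apply: eq_count => k /=; rewrite addnC. Qed.

Lemma leq_count_iota (P Q : pred nat) m n :
  (forall k, m <= k < m + n -> P k -> Q k) ->
  count P (iota m n) <= count Q (iota m n).
Proof.
elim: n m => //= n IH m PQ; rewrite leq_add ?IH // => [|k km].
  by case: (boolP (P m)) => // /(PQ m) ->; lia.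
by apply: PQ; lia.
Qed.

Lemma leq_count_iota_sub (P : pred nat) m n m' n' :
  m' <= m -> m + n <= m' + n' ->
  count P (iota m n) <= count P (iota m' n').
Proof.
move=> mm mn; have -> : n' = (m - m') + (n + (m' + n' - (m + n))) by lia.
rewrite iotaD count_cat iotaD count_cat (subnKC mm); lia.
Qed.

Lemma count_iota_lt (P : pred nat) N m n :
  (forall k, N <= k -> ~~ P k) -> count P (iota m n) <= N.
Proof.
move=> PN; apply: leq_trans (_ : count (fun k => k < N) (iota 0 (m + n)) <= _).
  apply: leq_trans (leq_count_iota_sub P (leq0n m) (leqnn _)) _.
  by apply: leq_count_iota => k _; apply: contraTT; rewrite -leqNgt => /PN.
case: (leqP N (m + n)) => Nn.
  rewrite -[m + n](subnKC Nn) iotaD count_cat add0n.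
  rewrite [X in _ + X](_ : _ = 0) ?addn0 ?(leq_trans (count_size _ _)) ?size_iota //.
  apply/eqP; rewrite -leqn0 leqNgt -has_count; apply/hasPn => k.
  by rewrite mem_iota -leqNgt => /andP[].
by rewrite (leq_trans (count_size _ _)) // size_iota ltnW.
Qed.

Lemma count_iota0 (P : pred nat) m n :
  (forall k, m <= k < m + n -> ~~ P k) -> count P (iota m n) = 0.
Proof.
move=> P0; apply/eqP; rewrite -leqn0 leqNgt -has_count; apply/hasPn => k.
by rewrite mem_iota => /P0.
Qed.

Lemma leq_count_progression (P Q : pred nat) D p r M :
  r < p -> (forall m, m < M -> Q m -> P (D + m * p + r)) ->
  count Q (iota 0 M) <= count P (iota D (M * p)).
Proof.
move=> rp; elim: M => [|M IH] QP //.
rewrite -addn1 iotaD count_cat mulnDl mul1n iotaD count_cat leq_add //.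
  by apply: IH => m mM; apply: QP; exact: leqW.
rewrite /= add0n addn0; case: (boolP (Q M)) => //= QM.
rewrite -has_count; apply/hasP; exists (D + M * p + r); last exact: QP.
by rewrite mem_iota leq_addr ltn_add2l.
Qed.

(** * Densities as counting conditions *)

Section PositiveDensity.

(* Classes 1 to 4: positive lower Banach, lower, upper and upper Banach
   density; class 5: infinite. *)
Definition positive (c : nat) (P : pred nat) : Prop :=
  match c with
  | 1 => exists q N, forall m n, N <= n -> n <= q * count P (iota m n)
  | 2 => exists q N, forall n, N <= n -> n <= q * count P (iota 0 n)
  | 3 => exists q, forall N, exists2 n, N <= n & n <= q * count P (iota 0 n)
  | 4 => exists q, forall N, exists m n, N <= n /\ n <= q * count P (iota m n)
  | _ => forall N, exists2 n, N <= n & P n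
  end.

Lemma pos_sub c P Q : {subset P <= Q} -> positive c P -> positive c Q.
Proof.
move=> PQ.
have le q m n : q * count P (iota m n) <= q * count Q (iota m n).
  by rewrite leq_mul2l sub_count ?orbT.
case: c => [|[|[|[|[|c]]]]] /=.
- by move=> H N; have [n ? /PQ] := H N; exists n.
- by move=> [q [N H]]; exists q, N => m n /(H m n) /leq_trans ->.
- by move=> [q [N H]]; exists q, N => n /H /leq_trans ->.
- by move=> [q H]; exists q => N; have [n ? /leq_trans] := H N; exists n; eauto.
- move=> [q H]; exists q => N; have [m [n [? h]]] := H N; exists m, n.
  by split=> //; exact: leq_trans h _.
- by move=> H N; have [n ? /PQ] := H N; exists n.
Qed.

Lemma posS c P : 0 < c -> positive c P -> positive c.+1 P.
Proof.
case: c => [|[|[|[|[|c]]]]] //= _.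
- by move=> [q [N H]]; exists q, N => n; exact: H.
- by move=> [q [N H]]; exists q => M; exists (maxn M N); rewrite ?leq_maxl ?H ?leq_maxr.
- by move=> [q H]; exists q => N; have [n Nn ?] := H N; exists 0, n.
(* An interval longer than [q * N] in which hits have proportion at least [1 / q] contains more than
   [N] hits, hence one at or beyond [N]. *)
- move=> [q H] N; have [m [n [qn nq]]] := H (q * N).+1.
  case: (boolP (has (fun k => (N <= k) && P k) (iota m n))) => [/hasP[k _ /andP[]]|].
    by exists k.
  move=> /hasPn noP; suff : count P (iota m n) <= N by nia.
  apply: leq_trans (_ : count (fun k => k < N) (iota m n) <= _).
    apply: leq_count_iota => k kmn Pk; rewrite ltnNge; apply/negP => Nk.
    by have := noP k; rewrite mem_iota kmn Nk Pk => /(_ isT).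
  by apply: count_iota_lt => k; rewrite -leqNgt.
Qed.

Lemma pos_leq c d P : 0 < c -> c <= d -> positive c P -> positive d P.
Proof.
move=> c0; elim: d => [|d IH]; first by lia.
rewrite leq_eqVlt ltnS => /predU1P[<-//|cd /(IH cd)]; apply: posS; lia.
Qed.

Lemma pos_ex c P : 0 < c <= 5 -> positive c P -> exists2 n, 0 < n & P n.
Proof. by move=> /andP[c0 c5] /(pos_leq c0 c5) /(_ 1)[n]; exists n. Qed.

(** Disjoint windows of length [p] contain a hit each; the factor 2 in [2 * p] pays for the
    incomplete last window. *)
Lemma syndetic_pos1 (P : pred nat) p :
  (forall m, exists2 n, m <= n < m + p & P n) -> positive 1 P.
Proof.
move=> Psynd; have p0 : 0 < p
  by have [n /andP[_ np] _] := Psynd 0; apply: leq_ltn_trans np.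
have cnt m M : M <= count P (iota m (M * p)).
  elim: M m => [//|M IH] m; rewrite mulSn iotaD count_cat.
  have [n nm Pn] := Psynd m; rewrite -add1n leq_add //.
  by rewrite -has_count; apply/hasP; exists n; rewrite ?mem_iota.
exists (2 * p), p => m n pn.
have := cnt m (n %/ p).
have := leq_count_iota_sub P (leqnn m) (_ : m + n %/ p * p <= m + n).
rewrite leq_add2l leq_divM => /(_ isT).
move=> le1 le2; have qC := leq_trans le2 le1.
have q0 : 0 < n %/ p by rewrite divn_gt0.
have := divn_eq n p; have := ltn_pmod n p0.
move: (n %/ p) (n %% p) qC q0 => q r qC q0 rp nE.
by apply: leq_trans (_ : 2 * p * q <= _); [nia|rewrite leq_mul2l qC orbT].
Qed.

End PositiveDensity.

(** * Gaps: long runs with bounded return times *)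

Section Gaps.

Lemma gap_len k j : j < k -> 6 * 8 ^ j <= 8 ^ k - 2 ^ k.
Proof.
case: k => // k; rewrite ltnS => jk.
have : 8 ^ j <= 8 ^ k by rewrite leq_exp2l.
have : 2 ^ k <= 8 ^ k by case: (posnP k) => [->//|k0]; rewrite leq_exp2r.
by rewrite !(expnS _ k); lia.
Qed.

Lemma gap_len_gt k : 0 < k -> k < 8 ^ k - 2 ^ k.
Proof.
case: k => // k _; have := gap_len (ltnSn k); have : k < 8 ^ k by rewrite ltn_expl.
lia.
Qed.

(** Level [k] consists of the last [2 ^ k] residues modulo [8 ^ k]: its runs grow with [k], while
    its density is only [4 ^ -k]. Levels beyond [n] cannot contain [n], which is then its own
    residue and too small. *)
Definition gap (n : nat) : bool :=
  has (fun k => 8 ^ k - 2 ^ k <= n %% 8 ^ k) (iota 1 n).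

Lemma gapP n :
  reflect (exists2 k, 0 < k & 8 ^ k - 2 ^ k <= n %% 8 ^ k) (gap n).
Proof.
apply: (iffP hasP) => -[k]; first by rewrite mem_iota => /andP[]; exists k.
move=> k0 kn; exists k => //; rewrite mem_iota k0 add1n ltnS leqNgt.
apply/negP => nk; have k8 := gap_len_gt k0.
have n8 : n < 8 ^ k by apply: leq_trans nk (leq_trans (ltnW k8) (leq_subr _ _)).
by rewrite modn_small // in kn; have := leq_trans k8 kn; lia.
Qed.

Lemma gap0 : ~~ gap 0. Proof. by []. Qed.

Lemma gap_run k i : i < 2 ^ k -> 0 < k ->
  forall m, gap (m * 8 ^ k + (8 ^ k - 2 ^ k) + i).
Proof.
move=> ik k0 m; apply/gapP; exists k => //.
have k28 : 2 ^ k <= 8 ^ k by rewrite leq_exp2r.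
by rewrite -addnA modnMDl modn_small; lia.
Qed.

(** There is no error term because the gaps sit at the end of each period, so that an incomplete
    period has no excess of them. *)
Lemma count_gap_level k M :
  4 ^ k * count (fun n => 8 ^ k - 2 ^ k <= n %% 8 ^ k) (iota 0 M) <= M.
Proof.
pose p := 8 ^ k; pose r := 2 ^ k.
have rp : p = 4 ^ k * r by rewrite /p /r -expnMn.
have r0 : 0 < r by rewrite expn_gt0.
have k40 : 0 < 4 ^ k by rewrite expn_gt0.
rewrite -/p -/r; set P := fun n => _.
have small N : N <= p -> count P (iota 0 N) <= N - (p - r).
  move=> Np; case: (leqP N (p - r)) => Npr.
    rewrite count_iota0 // => n; rewrite add0n => nN.
    by rewrite /P -ltnNge modn_small; lia.
  have -> : N = (p - r) + (N - (p - r)) by lia.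
  rewrite iotaD count_cat count_iota0 => [|n]; last first.
    by rewrite add0n => nN; rewrite /P -ltnNge modn_small; lia.
  by rewrite add0n (leq_trans (count_size _ _)) // size_iota; lia.
elim/ltn_ind: M => M IH; case: (leqP M p) => Mp.
  by have := small _ Mp; nia.
have -> : M = p + (M - p) by lia.
rewrite iotaD count_cat mulnDr leq_add //.
  have := small _ (leqnn p); nia.
rewrite add0n -[X in iota X]add0n -count_iota_shift.
rewrite (eq_count (a2 := P)); last by move=> n; rewrite /P modnDr.
by apply: IH; nia.
Qed.

Lemma count_has (I T : Type) (P : I -> pred T) (ks : seq I) (s : seq T) :
  count (fun n => has (fun k => P k n) ks) s <= \sum_(k <- ks) count (P k) s.
Proof.
elim: ks => [|k ks IH]; first by rewrite big_nil (@eq_count _ _ pred0) ?count_pred0.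
rewrite big_cons (leq_trans _ (leq_add (leqnn _) IH)) //.
rewrite -count_predUI (leq_trans _ (leq_addr _ _)) //.
Qed.

Lemma sum_div4 M K :
  3 * (\sum_(k <- iota 1 K) M %/ 4 ^ k) + M %/ 4 ^ K <= M.
Proof.
elim: K => [|K IH]; first by rewrite big_nil divn1.
rewrite -[K.+1]addn1 iotaD big_cat /= big_seq1 add1n addn1.
have -> : M %/ 4 ^ K.+1 = (M %/ 4 ^ K) %/ 4 by rewrite expnSr divnMA.
have := leq_divM (M %/ 4 ^ K) 4; lia.
Qed.

(** Union bound over the levels: by the geometric series of ratio 1/4, gaps fill at most a third of
    [[0, M)]. *)
Lemma count_nongap M : M <= 2 * count (fun m => ~~ gap m) (iota 0 M).
Proof.
have le3 : 3 * count gap (iota 0 M) <= M.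
  apply: leq_trans (leq_trans (leq_addr _ _) (sum_div4 M M)).
  rewrite leq_mul2l /=.
  pose P k n := 8 ^ k - 2 ^ k <= n %% 8 ^ k.
  apply: leq_trans (_ : count (fun n => has (P^~ n) (iota 1 M)) (iota 0 M) <= _).
    apply: leq_count_iota => n; rewrite add0n => nM /hasP[k].
    rewrite mem_iota => kn Pk; apply/hasP; exists k => //.
    by rewrite mem_iota; lia.
  apply: leq_trans (count_has _ _ _) _; apply: leq_sum => k _.
  by rewrite leq_divRL ?expn_gt0 // mulnC count_gap_level.
have := count_predC gap (iota 0 M); rewrite size_iota.
rewrite -[count (predC _) _]/(count (fun m => ~~ gap m) _).
lia.
Qed.

(* A base coded_point [D] of scale [j] creates no gap of its own: the gaps in
   [D, D + 8 ^ j) are the translates of those in [0, 8 ^ j). *)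
Definition gap_base (D j : nat) : Prop :=
  8 ^ j %| D /\ forall k, j < k -> D %% 8 ^ k + 8 ^ j <= 8 ^ k - 2 ^ k.

(** The gaps are self-similar. A level [k <= K] is already seen in [r]; a level with [K < k <= j]
    would make [m] a gap of level [k - K], because [2 ^ K <= 8 ^ K]; higher levels are excluded by
    [gap_base]. *)
Lemma gap_base_add D j K m r : gap_base D j ->
  m * 8 ^ K + r < 8 ^ j -> r < 8 ^ K -> ~~ gap m ->
  gap (D + (m * 8 ^ K + r)) -> gap r.
Proof.
move=> [Dj Dk] qj rK mG /gapP[k k0]; set q := m * _ + r.
have [kj|jk] := leqP k j.
  have /eqP D0 : D %% 8 ^ k == 0 by apply: dvdn_trans Dj; rewrite dvdn_exp2l.
  rewrite -modnDml D0 add0n /q => Hk.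
  have [kK|Kk] := leqP k K.
    apply/gapP; exists k => //.
    by rewrite -[K](subnK kK) expnD mulnA modnMDl in Hk.
  case/negP: mG; apply/gapP; exists (k - K); first lia.
  have eK : 8 ^ k = 8 ^ (k - K) * 8 ^ K by rewrite -expnD subnK // ltnW.
  have e2 : 2 ^ k = 2 ^ (k - K) * 2 ^ K by rewrite -expnD subnK // ltnW.
  have K28 : 2 ^ K <= 8 ^ K by case: (posnP K) => [->//|K0]; rewrite leq_exp2r.
  have m8 : (m * 8 ^ K + r) %% 8 ^ k = (m %% 8 ^ (k - K)) * 8 ^ K + r.
    rewrite eK {1}(divn_eq m (8 ^ (k - K))) mulnDl -mulnA -addnA modnMDl modn_small //.
    have := ltn_pmod m (_ : 0 < 8 ^ (k - K)); rewrite expn_gt0 => /(_ isT); nia.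
  rewrite m8 eK e2 in Hk.
  rewrite leqNgt; apply/negP => lt.
  have ab : 2 ^ (k - K) * 2 ^ K <= 2 ^ (k - K) * 8 ^ K by rewrite leq_mul2l K28 orbT.
  have lt' : (m %% 8 ^ (k - K) + 1 + 2 ^ (k - K)) * 8 ^ K <= 8 ^ (k - K) * 8 ^ K.
    by rewrite leq_mul2r; apply/orP; right; lia.
  move: lt'; rewrite (mulnDl _ (2 ^ _)) (mulnDl _ 1) mul1n; move: rK Hk ab; clear; lia.
rewrite leqNgt => /negP[]; have := Dk _ jk.
rewrite -modnDml; have := gap_len_gt k0 => ?.
have : 2 ^ k > 0 by rewrite expn_gt0.
by move=> ? ?; rewrite modn_small; lia.
Qed.

Lemma gap_base_pow s d : 0 < d <= 5 -> gap_base (d * 8 ^ s) s.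
Proof.
move=> d5; split; first exact: dvdn_mull.
move=> k sk; have := gap_len sk; have : 0 < 8 ^ s by rewrite expn_gt0.
by move=> ? ?; rewrite modn_small; nia.
Qed.

Lemma gap_base_pow2 s j : j < s -> gap_base (2 * 8 ^ s + 8 ^ j) j.
Proof.
move=> js; split; first by rewrite dvdn_add // dvdn_mull // dvdn_exp2l // ltnW.
move=> k jk; have j0 : 0 < 8 ^ j by rewrite expn_gt0.
have [ks|sk] := leqP k s.
  have -> : 2 * 8 ^ s + 8 ^ j = (2 * 8 ^ (s - k)) * 8 ^ k + 8 ^ j.
    by rewrite -mulnA -expnD subnK.
  by rewrite modnMDl modn_small; have := gap_len jk; lia.
have := gap_len sk; have : 8 ^ j.+1 <= 8 ^ s by rewrite leq_exp2l.
by rewrite expnS => ? ?; rewrite modn_small; lia.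
Qed.

End Gaps.

(** * Times with base 8 digits 0 and 1 *)

Section SparseSet.

Definition sparse (n : nat) : bool :=
  all (fun k => (n %/ 8 ^ k) %% 8 <= 1) (iota 0 n).

Lemma sparseP n : reflect (forall k, (n %/ 8 ^ k) %% 8 <= 1) (sparse n).
Proof.
apply: (iffP allP) => H k; last by [].
have [kn|nk] := ltnP k n; first by apply: H; rewrite mem_iota.
by rewrite divn_small // (leq_ltn_trans nk) // ltn_expl.
Qed.

Lemma sparse_addpow s r : r < 8 ^ s -> sparse r -> sparse (8 ^ s + r).
Proof.
move=> rs /sparseP H; apply/sparseP => k.
have [ks|sk] := ltnP k s.
  have -> : 8 ^ s = 8 ^ (s - k.+1) * 8 * 8 ^ k by rewrite -mulnA -expnS -expnD subnK.
  by rewrite divnMDl ?expn_gt0 // modnMDl.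
have [->|neq] := eqVneq k s.
  by rewrite -{1}[8 ^ s]mul1n divnMDl ?expn_gt0 // divn_small.
rewrite divn_small //.
have : 8 ^ s.+1 <= 8 ^ k by rewrite leq_exp2l //; lia.
by rewrite expnS; lia.
Qed.

(** Of the eight subblocks one scale below, only the two with digit 0 or 1 meet [sparse], so the
    count at most doubles at each scale. *)
Lemma count_sparse_block k m : count sparse (iota (m * 8 ^ k) (8 ^ k)) <= 2 ^ k.
Proof.
elim: k m => [|k IH] m; first by rewrite (leq_trans (count_size _ _)) // size_iota.
have e8 : 0 < 8 ^ k by rewrite expn_gt0.
have -> : 8 ^ k.+1 = 8 ^ k + (8 ^ k + 6 * 8 ^ k) by rewrite expnS; lia.
rewrite iotaD count_cat iotaD count_cat.
have -> : m * (8 ^ k + (8 ^ k + 6 * 8 ^ k)) = 8 * m * 8 ^ k by lia.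
rewrite (_ : 8 * m * 8 ^ k + 8 ^ k = (8 * m).+1 * 8 ^ k); last lia.
rewrite [X in _ + (_ + X)]count_iota0 => [|n nk].
  by have := IH (8 * m); have := IH (8 * m).+1; rewrite expnS; lia.
apply/negP => /sparseP /(_ k).
have : 8 * m + 2 <= n %/ 8 ^ k by rewrite leq_divRL //; lia.
have : n %/ 8 ^ k < 8 * m + 8 by rewrite ltn_divLR //; lia.
lia.
Qed.

Lemma count_sparse k m n :
  8 ^ k * count sparse (iota m n) <= (n + 2 * 8 ^ k) * 2 ^ k.
Proof.
have e8 : 0 < 8 ^ k by rewrite expn_gt0.
have blocks a b : count sparse (iota (a * 8 ^ k) (b * 8 ^ k)) <= b * 2 ^ k.
  elim: b => // b IH; rewrite -(addn1 b) mulnDl iotaD count_cat mulnDl leq_add //.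
  by rewrite !mul1n -mulnDl count_sparse_block.
pose a := m %/ 8 ^ k; pose b := n %/ 8 ^ k + 2.
have am : a * 8 ^ k <= m by exact: leq_divM.
have mn : m + n <= a * 8 ^ k + b * 8 ^ k.
  have := divn_eq m (8 ^ k); have := divn_eq n (8 ^ k).
  have := ltn_pmod m e8; have := ltn_pmod n e8; rewrite /a /b; nia.
have := leq_count_iota_sub sparse am mn; have := blocks a b.
have bn : b * 8 ^ k <= n + 2 * 8 ^ k by rewrite mulnDl leq_add2r leq_divM.
move=> h1 h2; apply: leq_trans (_ : 8 ^ k * (b * 2 ^ k) <= _).
  by rewrite leq_mul2l (leq_trans h2) ?orbT.
by rewrite mulnA [8 ^ k * b]mulnC leq_mul2r bn orbT.
Qed.

(** In intervals of length at least [2 * 8 ^ k] the proportion is at most [2 / 4 ^ k], which is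
    below [1 / q] for [k = q.+1]. *)
Lemma sparse_npos4 : ~ positive 4 sparse.
Proof.
move=> [q H]; have [m [n [Nn nq]]] := H (2 * 8 ^ q.+1).
have := count_sparse q.+1 m n.
have e : 8 ^ q.+1 = 4 ^ q.+1 * 2 ^ q.+1 by rewrite -expnMn.
have q4 : q.+1 < 4 ^ q.+1 by rewrite ltn_expl.
have q20 : 0 < 2 ^ q.+1 by rewrite expn_gt0.
set C := count _ _ in nq *.
rewrite e in Nn *; move: q4 q20 Nn.
set A := 4 ^ _; set B := 2 ^ _ => q4 q20 Nn h.
have {}h : A * C <= 2 * n.
  rewrite -(leq_pmul2r q20); nia.
have n0 : 0 < n by nia.
have q5 : 2 * q < A.
  by have : q < 4 ^ q; [rewrite ltn_expl | rewrite /A expnS; lia].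
have C0 : 0 < C by case: (C) nq => //; lia.
have : A * C <= 2 * q * C by apply: leq_trans h _; nia.
by rewrite leq_pmul2r //; lia.
Qed.

End SparseSet.

(** * The coded sequence *)

Lemma trunc_log8 s d r : 0 < d < 8 -> r < 8 ^ s ->
  trunc_log 8 (d * 8 ^ s + r) = s.
Proof.
move=> d8 rs; apply: trunc_log_eq => //; rewrite expnS; apply/andP; split; nia.
Qed.

Lemma divmod8 s d r : r < 8 ^ s ->
  ((d * 8 ^ s + r) %/ 8 ^ s = d) * ((d * 8 ^ s + r) %% 8 ^ s = r).
Proof.
move=> rs; split; first by rewrite divnMDl ?expn_gt0 // divn_small ?addn0.
by rewrite modnMDl modn_small.
Qed.

(** The 2-adic valuation takes every value infinitely often; the schedule uses it to return to each
    word forever. *)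
Lemma logn2_unbounded t N : exists2 e, N <= e & logn 2 e = t.
Proof.
exists (2 ^ t * N.*2.+1).
  have : 0 < 2 ^ t by rewrite expn_gt0.
  by rewrite -addnn; nia.
rewrite lognM ?expn_gt0 // pfactorK // logn_coprime ?addn0 //.
by rewrite coprime2n /= odd_double.
Qed.

(** * Bursts after the powers of 8 *)

Section Burst.

Definition burst (n : nat) : bool :=
  (n %/ 8 ^ trunc_log 8 n == 1) && (n %% 8 ^ trunc_log 8 n < trunc_log 8 n).

Lemma count_burst s : count burst (iota 0 (8 ^ s)) <= s ^ 2.
Proof.
elim: s => [//|s IH].
have e8 : 0 < 8 ^ s by rewrite expn_gt0.
have -> : 8 ^ s.+1 = 8 ^ s + (s + (8 ^ s.+1 - (8 ^ s + s))).
  by have := ltn_expl s (isT : 1 < 8); rewrite expnS; lia.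
rewrite !iotaD !count_cat add0n [X in _ + (_ + X)]count_iota0 => [|n nk].
  have : count burst (iota (8 ^ s) s) <= s.
    by rewrite (leq_trans (count_size _ _)) // size_iota.
  by rewrite addn0 -!mulnn; nia.
have ns : trunc_log 8 n = s.
  apply: trunc_log_eq => //; have := ltn_expl s (isT : 1 < 8).
  by rewrite expnS in nk *; lia.
rewrite /burst ns; apply/negP => /andP[/eqP n1 ns']; have := divn_eq n (8 ^ s).
rewrite n1; lia.
Qed.

(** Bursts below [8 ^ s] have total length at most [s ^ 2], so their number below [n] is of the
    order of a squared logarithm. *)
Lemma burst_sublinear q i : exists N, forall n, N <= n ->
  q * count burst (iota 0 (n + i)) < n.
Proof.
exists (8 ^ (q + i + 1)) => n nN.
pose s := trunc_log 8 (n + i).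
have n0 : 0 < n by apply: leq_trans nN; rewrite expn_gt0.
have /andP[sn ns] : 8 ^ s <= n + i < 8 ^ s.+1.
  by apply: trunc_log_bounds => //; rewrite addn_gt0 n0.
have := count_burst s.+1.
have sqi : q + i + 1 <= s.
  by apply: trunc_log_max => //; rewrite (leq_trans nN) ?leq_addr.
have le := leq_count_iota_sub burst (leqnn 0) (ltnW ns : 0 + _ <= 0 + _).
have s4 : s.+1 ^ 2 <= 4 ^ s.
  by rewrite -[4]/(2 ^ 2) -expnM mulnC expnM leq_exp2r // ltn_expl.
have s2 : s < 2 ^ s by rewrite ltn_expl.
have e8 : 8 ^ s = 4 ^ s * 2 ^ s by rewrite -expnMn.
move=> /(leq_trans le) /leq_trans /(_ s4) {le}.
set C := count _ _ => CA; rewrite e8 in sn.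
have A0 : 0 < 4 ^ s by rewrite expn_gt0.
move: (4 ^ s) (2 ^ s) CA sn s2 A0 {s4 e8} => A B CA sn s2 A0.
have : q * C <= q * A by rewrite leq_mul2l CA orbT.
nia.
Qed.

End Burst.

Section Construction.
(* The digits of the code are [alpha 1], ..., [alpha 6]. *)
Variable alpha : nat -> bool.

(** * Letters, legal words and the schedule *)

Definition first_class : nat :=
  if ~~ alpha 1 then 1 else if ~~ alpha 2 then 2 else 3.

Lemma first_class_bounds : 0 < first_class <= 3.
Proof. by rewrite /first_class; do 2?case: ifP. Qed.

Lemma first_class_le c : 0 < c -> ~~ alpha c -> first_class <= c.
Proof.
rewrite /first_class; case: c => [|[|[|c]]] // _; last by do 2?case: ifP.
  by move=> ->.
by move=> ->; case: ifP.
Qed.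

(** Letters of class at most [c]. A letter [a] from 2 to 5 has class [a] and exists only if digit
    [a] is strict; nothing but the filler 0 can have class 1, since only zeros are imposed
    syndetically. *)
Definition letter (c a : nat) : bool :=
  (a == 0) && (first_class <= c) || [&& 1 < a, a <= 5, a <= c & ~~ alpha a].

Lemma letter_mono c d a : c <= d -> letter c a -> letter d a.
Proof. rewrite /letter; lia. Qed.

Lemma letter_nonempty c a : letter c a -> first_class <= c.
Proof.
case/orP => [/andP[]//|/and4P[a1 _ ac aA]].
by apply: leq_trans ac; apply: first_class_le => //; lia.
Qed.

Lemma letter_le5 c a : letter c a -> a <= 5.
Proof. rewrite /letter; lia. Qed.

Lemma letter0 c : letter c 0 = (first_class <= c).
Proof. by rewrite /letter orbF. Qed.

Lemma letter_refine c : 0 < c <= 5 ->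
  ~~ alpha c -> exists a, letter c a && ~~ letter c.-1 a.
Proof.
move=> c5 ac; have := first_class_le (_ : 0 < c) ac; rewrite (andP c5).1 => /(_ isT).
have := first_class_bounds => fb.
rewrite leq_eqVlt => /predU1P[fc|fc].
  by exists 0; rewrite !letter0; lia.
by exists c; rewrite /letter; lia.
Qed.

Definition masked (n : nat) : bool := (first_class == 1) && gap n.

Lemma masked0 : ~~ masked 0. Proof. by rewrite /masked negb_and gap0 orbT. Qed.

(** [n0] is a position where both the gaps and [sparse] tolerate the word; copies are placed at
    suitable translates of [n0] so as to stay tolerated. *)
Definition legal (c : nat) (z : nat -> nat) (l : nat) : Prop :=
  exists n0, forall i, i < l ->
    [/\ letter c (z i), masked (n0 + i) -> z i = 0 & z i = 5 -> sparse (n0 + i)].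

(* The class [c] and the index [t] of the word copied at time [n].  When
   [first_class = 3] nothing may have positive lower density, so that the times
   reserved for class 2 are returned to class 3. *)
Definition sched (n : nat) : nat * nat :=
  let s := trunc_log 8 n in
  if burst n then (5, logn 2 s)
  else if (n %/ 8 ^ s == 2) && (first_class <= 2)
  then (2, s - 1 - trunc_log 8 (n %% 8 ^ s))
  else (3, logn 2 (trunc_log 2 s)).

(* Index [t] stands for the word [v] repeated with period [8 ^ K], where
   [(K, v)] is the value of [decode t]. *)
Definition decode (t : nat) : nat * seq nat := odflt (0, [::]) (unpickle t).

Lemma decodeK v : decode (pickle v) = v.
Proof. by rewrite /decode pickleK. Qed.

Definition raw_letter (t n : nat) : nat :=
  nth 0 (decode t).2 (n %% 8 ^ (decode t).1).

(** A letter forbidden by the class of the time, or by [sparse] in the case of 5, is replaced by the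
    filler. *)
Definition coded (n : nat) : nat :=
  if (n == 0) && ~~ alpha 6 then 6
  else if masked n then 0
  else let a := raw_letter (sched n).2 n in
       if letter (sched n).1 a && ((a == 5) ==> sparse n) then a else 0.

Definition occ (z : nat -> nat) (l n : nat) : bool :=
  all (fun i => coded (n + i) == z i) (iota 0 l).

Lemma occP z l n : reflect (forall i, i < l -> coded (n + i) = z i) (occ z l n).
Proof.
apply: (iffP allP) => H i; first by move=> il; apply/eqP/H; rewrite mem_iota.
by rewrite mem_iota => /H ->.
Qed.

Lemma sched_class n : [\/ (sched n).1 = 5 /\ burst n,
   (sched n).1 = 2 /\ first_class <= 2 | (sched n).1 = 3].
Proof.
rewrite /sched; case: ifP => b; first by constructor 1.
by case: ifP => [/andP[_ ?]|_]; [constructor 2|constructor 3].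
Qed.

Lemma coded_gt0 n : 0 < n -> coded n = if masked n then 0
  else if letter (sched n).1 (raw_letter (sched n).2 n)
          && ((raw_letter (sched n).2 n == 5) ==> sparse n)
       then raw_letter (sched n).2 n else 0.
Proof. by case: n. Qed.

Lemma coded_masked n : 0 < n -> masked n -> coded n = 0.
Proof. by move=> n0 mn; rewrite coded_gt0 // mn. Qed.

Lemma coded_sched n : coded n <> 0 -> 0 < n -> letter (sched n).1 (coded n).
Proof.
by move=> + n0; rewrite coded_gt0 //; case: ifP => // _; case: ifP => // /andP[].
Qed.

Lemma coded_letter5 n : 0 < n -> letter 5 (coded n).
Proof.
move=> n0; have [->|/eqP x0] := eqVneq (coded n) 0.
  by rewrite letter0; have := first_class_bounds; lia.
by apply: letter_mono (coded_sched x0 n0); case: (sched_class n) => [[-> _]|[-> _]|->].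
Qed.

Lemma coded_sparse n : coded n = 5 -> sparse n.
Proof.
have [->//|n0] := posnP n.
rewrite coded_gt0 //; case: ifP => // _.
by case: ifP => // /andP[_ /implyP h] a5; apply: h; apply/eqP.
Qed.

Lemma coded_le6 n : coded n <= 6.
Proof.
have [->|n0] := posnP n; last by apply: leqW; apply: letter_le5 (coded_letter5 n0).
rewrite /coded; case: ifP => // _; case: ifP => // _.
by case: ifP => // /andP[/letter_le5 ? _]; exact: leqW.
Qed.

Lemma coded0 : ~~ alpha 6 -> coded 0 = 6. Proof. by move=> a6; rewrite /coded a6. Qed.

Lemma coded0_letter : alpha 6 -> letter 3 (coded 0).
Proof.
move=> a6; rewrite /coded eqxx a6 andbF (negbTE masked0).
case: ifP => [/andP[h _]|_]; last by rewrite letter0; have := first_class_bounds; lia.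
by apply: letter_mono h; case: (sched_class 0) => [[_ //]|[-> _]|->].
Qed.

(** * Occurrences of legal words *)

Lemma sched_burst s q : q < s -> sched (8 ^ s + q) = (5, logn 2 s).
Proof.
move=> qs; have q8 : q < 8 ^ s by rewrite (ltn_trans qs) // ltn_expl.
have e : 8 ^ s + q = 1 * 8 ^ s + q by rewrite mul1n.
have ns : trunc_log 8 (8 ^ s + q) = s by rewrite e trunc_log8.
by rewrite /sched /burst ns e !divmod8 // eqxx qs.
Qed.

(** After a leading digit 2, the place of the next nonzero digit encodes the index, so that each
    index fills the same proportion of every large scale. *)
Lemma sched_lower t j q : first_class <= 2 -> q < 8 ^ j ->
  sched (2 * 8 ^ (j + t.+1) + 8 ^ j + q) = (2, t).
Proof.
move=> fc qj; rewrite -addnA.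
have rs : 8 ^ j + q < 8 ^ (j + t.+1).
  have : 8 ^ j.+1 <= 8 ^ (j + t.+1) by rewrite leq_exp2l //; lia.
  by rewrite expnS; lia.
have ns : trunc_log 8 (2 * 8 ^ (j + t.+1) + (8 ^ j + q)) = j + t.+1.
  by rewrite trunc_log8.
have nj : trunc_log 8 (8 ^ j + q) = j by rewrite -[8 ^ j]mul1n trunc_log8.
rewrite /sched /burst ns !divmod8 // fc nj eqxx; congr (_, _); lia.
Qed.

Lemma sched_epoch s q : q < 8 ^ s ->
  sched (4 * 8 ^ s + q) = (3, logn 2 (trunc_log 2 s)).
Proof.
move=> qs; have ns : trunc_log 8 (4 * 8 ^ s + q) = s by rewrite trunc_log8.
by rewrite /sched /burst ns !divmod8.
Qed.

(** [D] is a multiple of the period, so copy number [m] of [v] shows [z] at offset [n0]. As [m] is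
    not a gap, masking there comes only from residues [n0 + i] that are themselves masked, where [z]
    is already 0. *)
Lemma occ_block c z l K v n0 D j m :
  n0 + l <= 8 ^ K -> (forall i, i < l -> nth 0 v (n0 + i) = z i) ->
  0 < D -> gap_base D j -> m.+1 * 8 ^ K <= 8 ^ j -> ~~ gap m ->
  (forall i, i < l -> [/\ letter c (z i), masked (n0 + i) -> z i = 0
     & z i = 5 -> sparse (D + m * 8 ^ K + n0 + i)]) ->
  (forall i, i < l -> exists2 c', c <= c'
     & sched (D + m * 8 ^ K + n0 + i) = (c', pickle (K, v))) ->
  occ z l (D + m * 8 ^ K + n0).
Proof.
move=> n0K vz D0 Dj mj mG zP sP; apply/occP => i il.
have [zl zm zs] := zP i il; have [c' cc' sc] := sP i il.
rewrite coded_gt0; last by lia.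
have iK : n0 + i < 8 ^ K by lia.
have e8 : 0 < 8 ^ K by rewrite expn_gt0.
have Kj : K <= j.
  by rewrite -(@leq_exp2l 8) // (leq_trans _ mj) // leq_pmull.
have KD : 8 ^ K %| D by apply: dvdn_trans Dj.1; rewrite dvdn_exp2l.
have rawE : raw_letter (pickle (K, v)) (D + m * 8 ^ K + n0 + i) = z i.
  rewrite /raw_letter decodeK /= -addnA -modnDml -[(D + _) %% _]modnDml (eqP KD).
  by rewrite add0n modnMl add0n modn_small // vz.
rewrite sc rawE (letter_mono cc' zl) /=; case: ifP => [|_].
  move=> /andP[fc gN]; rewrite zm // /masked fc /=.
  apply: (gap_base_add Dj _ iK mG); last by rewrite addnA addnA.
  by move: mj; rewrite mulSn; lia.
by case: ifP => // /negbT; rewrite negb_imply => /andP[/eqP /zs ->].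
Qed.

(** The word holds [z] at its legal offset [n0], in a period [8 ^ K] exceeding [n0 + l]; at least
    half of the copies have a number that is not a gap. Below class 5, no letter is restricted to
    [sparse]. *)
Lemma occ_block_count c z l : c <= 4 -> legal c z l ->
  exists K t, forall c' D j M, c <= c' -> 0 < D -> gap_base D j ->
    M * 8 ^ K <= 8 ^ j ->
    (forall q, q < M * 8 ^ K -> sched (D + q) = (c', t)) ->
    M <= 2 * count (occ z l) (iota D (M * 8 ^ K)).
Proof.
move=> c4 [n0 zP]; pose K := n0 + l.
pose v := mkseq (fun i => z (i - n0)) K; exists K, (pickle (K, v)).
move=> c' D j M cc' D0 Dj Mj sP.
have K8 : K < 8 ^ K by rewrite ltn_expl.
apply: leq_trans (count_nongap M) _; rewrite leq_mul2l /=.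
have [->|l0] := posnP l.
  apply: leq_trans (count_size _ _) _; rewrite size_iota.
  rewrite (@eq_count _ _ predT) // count_predT size_iota leq_pmulr //; lia.
apply: (@leq_count_progression _ _ _ _ n0) => [|m mM mG]; first by lia.
have mM8 : m.+1 * 8 ^ K <= M * 8 ^ K by rewrite leq_mul2r mM orbT.
apply: (@occ_block c z l K v n0 D j) => //; first exact: ltnW.
- by move=> i il; rewrite nth_mkseq ?addKn // ltn_add2l.
- exact: leq_trans mM8 Mj.
- move=> i il; have [zl zm zs] := zP i il; split=> // z5.
  by move: zl c4; rewrite z5 /letter; lia.
- move=> i il; exists c' => //; rewrite -!addnA sP //.
  by move: mM8; rewrite mulSn; rewrite /K in K8 *; lia.
Qed.

Lemma pos_occ1 z : (forall l, legal 1 z l) -> forall l, positive 1 (occ z l).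
Proof.
move=> zP l.
have fc : first_class = 1.
  have [n0 /(_ 0 isT)[/letter_nonempty]] := zP 1.
  by have := first_class_bounds; lia.
have z0 i : i < l -> z i = 0.
  by move=> il; have [n0 /(_ i il)[]] := zP l; rewrite /letter; lia.
have l2 : l.+1 < 2 ^ l.+1 by rewrite ltn_expl.
have e28 : 2 ^ l.+1 <= 8 ^ l.+1 by rewrite leq_exp2r.
apply: (@syndetic_pos1 _ (2 * 8 ^ l.+1)) => m.
(* Start of the gap run of level [l.+1] in the period following that of [m]; class 1 words consist
   of zeros. *)
exists (((m %/ 8 ^ l.+1).+1 * 8 ^ l.+1) + (8 ^ l.+1 - 2 ^ l.+1)).
  have := divn_eq m (8 ^ l.+1).
  have := ltn_pmod m (_ : 0 < 8 ^ l.+1); rewrite expn_gt0 => /(_ isT).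
  by rewrite mulSn; lia.
apply/occP => i il; rewrite z0 // coded_masked //.
  by rewrite mulSn; lia.
by rewrite /masked fc eqxx gap_run //; lia.
Qed.

Lemma pos_occ2 z : (forall l, legal 2 z l) -> forall l, positive 2 (occ z l).
Proof.
move=> zP l.
have fc : first_class <= 2 by have [n0 /(_ 0 isT)[/letter_nonempty]] := zP 1.
have [K [t Kt]] := occ_block_count (isT : 2 <= 4) (zP l).
exists (2 * 8 ^ (t + K + 3)), (8 ^ (t + K + 2)) => n nN.
have n0 : 0 < n by rewrite (leq_trans _ nN) // expn_gt0.
have /andP[sn ns] := trunc_log_bounds (isT : 1 < 8) n0.
have tKs := trunc_log_max (isT : 1 < 8) nN.
move: (trunc_log 8 n) => s' in sn ns tKs.
(* Selects the block of index [t] at scale [s' - 1], the last scale completed by time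
   [8 ^ s' <= n]. *)
pose j := s' - t - 2; have Kj : K <= j by rewrite /j; lia.
have js : s' = (j + t.+1).+1 by rewrite /j; lia.
pose D := 2 * 8 ^ (j + t.+1) + 8 ^ j.
have := Kt 2 D j (8 ^ (j - K)); rewrite -expnD subnK // => /(_ isT) H.
have {H} : 8 ^ (j - K) <= 2 * count (occ z l) (iota D (8 ^ j)).
  apply: H => //; first by rewrite /D addn_gt0 expn_gt0 orbT.
    by apply: gap_base_pow2; lia.
  by move=> q qj; rewrite sched_lower.
have Dn : D + 8 ^ j <= 0 + n.
  have : 8 ^ j.+1 <= 8 ^ (j + t.+1) by rewrite leq_exp2l //; lia.
  by move: sn; rewrite js /D !expnS; lia.
have := leq_count_iota_sub (occ z l) (leq0n D) Dn.
move=> le1 le2; apply: leq_trans (ltnW ns) _.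
have -> : 8 ^ s'.+1 = 8 ^ (t + K + 3) * 8 ^ (j - K).
  by rewrite -expnD; congr (8 ^ _); lia.
rewrite [2 * _]mulnC -mulnA leq_mul2l; apply/orP; right.
by apply: leq_trans le2 _; rewrite leq_mul2l.
Qed.

Lemma pos_occ3 z : (forall l, legal 3 z l) -> forall l, positive 3 (occ z l).
Proof.
move=> zP l; have [K [t Kt]] := occ_block_count (isT : 3 <= 4) (zP l).
exists (10 * 8 ^ K) => N.
have [e Ne et] := logn2_unbounded t (N + K).
(* [trunc_log 2 s] is [e], of valuation [t], so this epoch runs the word of index [t]; the leading
   digit 4 used below avoids bursts and class 2 times. *)
pose s := 2 ^ e; have es : e < s by rewrite ltn_expl.
have Ks : K <= s by lia.
have Ns : N <= 8 ^ s by have : s < 8 ^ s; [rewrite ltn_expl | lia].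
exists (5 * 8 ^ s); first by lia.
have := Kt 3 (4 * 8 ^ s) s (8 ^ (s - K)); rewrite -expnD subnK // => /(_ isT) H.
have {H} : 8 ^ (s - K) <= 2 * count (occ z l) (iota (4 * 8 ^ s) (8 ^ s)).
  apply: H => //; first by rewrite muln_gt0 expn_gt0.
    exact: gap_base_pow.
  by move=> q qs; rewrite sched_epoch // trunc_expnK // et.
have le : 4 * 8 ^ s + 8 ^ s <= 0 + 5 * 8 ^ s by lia.
have := leq_count_iota_sub (occ z l) (leq0n _) le => le1 le2.
set C := count _ (iota 0 _) in le2 *.
have AC : 8 ^ (s - K) <= 2 * C by lia.
have : 8 ^ K * 8 ^ (s - K) <= 8 ^ K * (2 * C) by rewrite leq_mul2l AC orbT.
by rewrite -expnD subnKC //; lia.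
Qed.

Lemma pos_occ4 z : (forall l, legal 4 z l) -> forall l, positive 4 (occ z l).
Proof.
move=> zP l; have [K [t Kt]] := occ_block_count (isT : 4 <= 4) (zP l).
have e8 : 0 < 8 ^ K by rewrite expn_gt0.
exists (4 * 8 ^ K) => N; have [s Ns st] := logn2_unbounded t (N + 8 ^ K).
have s8 : s < 8 ^ s by rewrite ltn_expl.
have Ms := leq_divM s (8 ^ K).
exists (8 ^ s), s; split; first by lia.
have : s %/ 8 ^ K <= 2 * count (occ z l) (iota (8 ^ s) (s %/ 8 ^ K * 8 ^ K)).
  (* Bursts have class 5, which admits the letters of class 4 too. *)
  apply: (Kt 5 _ s) => //; first by rewrite expn_gt0.
  - by rewrite -[8 ^ s]mul1n; apply: gap_base_pow.
  - by lia.
  - by move=> q qs; rewrite sched_burst ?st //; exact: leq_trans qs Ms.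
have le : 8 ^ s + s %/ 8 ^ K * 8 ^ K <= 8 ^ s + s by rewrite leq_add2l.
have := leq_count_iota_sub (occ z l) (leqnn _) le => le1 le2.
have M0 : 0 < s %/ 8 ^ K by rewrite divn_gt0 //; lia.
have := divn_eq s (8 ^ K); have := ltn_pmod s e8.
set C := count _ (iota _ s) in le1 *; set M := s %/ _ in le1 le2 M0 *.
move=> rK sE; have MC : M <= 2 * C by lia.
have : 8 ^ K * M <= 8 ^ K * (2 * C) by rewrite leq_mul2l MC orbT.
have : 8 ^ K * 1 <= 8 ^ K * M by rewrite leq_mul2l M0 orbT.
rewrite [4 * _]mulnC -mulnA; move: rK sE; rewrite [M * _]mulnC; lia.
Qed.

Lemma pos_occ5 z : (forall l, legal 5 z l) -> forall l, positive 5 (occ z l).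
Proof.
move=> zP l N; have [n0 zn] := zP l; pose K := n0 + l.
pose v := mkseq (fun i => z (i - n0)) K.
have K8 : K < 8 ^ K by rewrite ltn_expl.
have [s Ns st] := logn2_unbounded (pickle (K, v)) (N + 8 ^ K).
have s8 : s < 8 ^ s by rewrite ltn_expl.
have n0s i : i < l -> n0 + i < s.
  by move=> il; have : n0 + l < 8 ^ K by []; lia.
(* Only copy 0 of a burst is used: putting the digit 1 of [8 ^ s] in front of [n0 + i] preserves
   [sparse]. *)
exists (8 ^ s + 0 * 8 ^ K + n0); first by lia.
apply: (@occ_block 5 z l K v n0 (8 ^ s) s) => //; first exact: ltnW.
- by move=> i il; rewrite nth_mkseq ?addKn // ltn_add2l.
- by rewrite expn_gt0.
- by rewrite -[8 ^ s]mul1n; apply: gap_base_pow.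
- by rewrite mul1n; lia.
- move=> i il; have [zl zm zs] := zn i il; split=> // z5.
  by rewrite mul0n addn0 -addnA sparse_addpow ?zs // (ltn_trans (n0s i il)).
- move=> i il; exists 5 => //; rewrite mul0n addn0 -addnA sched_burst ?st //.
  exact: n0s.
Qed.

Lemma pos_occ c z : 0 < c <= 5 ->
  (forall l, legal c z l) -> forall l, positive c (occ z l).
Proof.
case: c => [|[|[|[|[|[|c]]]]]] // _.
- exact: pos_occ1.
- exact: pos_occ2.
- exact: pos_occ3.
- exact: pos_occ4.
- exact: pos_occ5.
Qed.

(** A word of the sequence is legal at the very time where it is read. *)
Lemma legal_orbit k l : (0 < k) || alpha 6 -> legal 5 (fun i => coded (k + i)) l.
Proof.
move=> k0; exists k => i _; have [ki0|ki0] := posnP (k + i); last first.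
  by split; [exact: coded_letter5|exact: coded_masked|exact: coded_sparse].
have a6 : alpha 6 by move: k0; rewrite (_ : k = 0) //; lia.
rewrite ki0; split; last exact: coded_sparse.
  exact: letter_mono (coded0_letter a6).
by rewrite (negbTE masked0).
Qed.

Lemma legal_single c a l : letter c a -> legal c (fun i => if i == 0 then a else 0) l.
Proof.
move=> ca; exists 0 => -[|i] _ /=.
  by split=> //; rewrite (negbTE masked0).
by split=> //; rewrite letter0 (letter_nonempty ca).
Qed.

Lemma legal_sub c c' z l : (forall a, letter c a -> letter c' a) ->
  legal c z l -> legal c' z l.
Proof. by move=> cc' [n zP]; exists n => i /zP[/cc' ? ? ?]. Qed.

Lemma raw_const b n : raw_letter (pickle (0, [:: b])) n = b.
Proof. by rewrite /raw_letter decodeK modn1. Qed.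

(** * Letters whose density vanishes *)

Hypothesis alphaP : ~~ [&& alpha 1, alpha 2 & alpha 3].

(** Admissibility makes the default value 3 of [first_class] a genuine strict inclusion. *)
Lemma alpha_first_class : ~~ alpha first_class.
Proof.
move: alphaP; rewrite /first_class.
case a1: (alpha 1); last by rewrite /= a1.
by case a2: (alpha 2); rewrite //= a2.
Qed.

Lemma letter_stable c a : 0 < c -> alpha c -> letter c a = letter c.-1 a.
Proof.
move=> c0 ac; rewrite /letter.
have fc : first_class != c by apply/eqP => e; have := alpha_first_class; rewrite e ac.
have [->|a0] := eqVneq a 0; first by lia.
have [eac|] := eqVneq a c; last by lia.
by rewrite eac ac /= !andbF.
Qed.

(** A constant word suffices: zeros if [a] is not 0; otherwise the letter [first_class], which is
    then above 1, so that no time is masked. *)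
Lemma burst_word_avoids c a : 0 < c -> ~~ letter c a ->
  exists t, forall n, 0 < n -> (sched n).2 = t -> 3 <= (sched n).1 ->
    coded n <> a.
Proof.
move=> c0; have [->|a0] := eqVneq a 0 => ca.
  have fc : 1 < first_class by move: ca; rewrite letter0; lia.
  exists (pickle (0, [:: first_class])) => n n0 st sc.
  have fb := first_class_bounds; have af := alpha_first_class.
  have f1 : (first_class == 1) = false by lia.
  rewrite coded_gt0 // /masked f1 andFb st raw_const ifT; first by lia.
  by rewrite /letter; lia.
exists (pickle (0, [:: 0])) => n n0 st _.
rewrite coded_gt0 // st raw_const !if_same.
by apply/eqP; rewrite eq_sym.
Qed.

(** Arbitrarily long bursts run a constant word that avoids [a]. *)
Lemma npos_letter1 a i : ~~ letter 1 a -> ~ positive 1 (fun n => coded (n + i) == a).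
Proof.
move=> la [q [N H]]; have [t ta] := burst_word_avoids (isT : 0 < 1) la.
have [s Ns st] := logn2_unbounded t (N + i + 1).
have s8 : s < 8 ^ s by rewrite ltn_expl.
have := H (8 ^ s) (s - i); rewrite count_iota0 ?muln0 => [|n nk]; first by lia.
apply/negP => /eqP; have ns : n + i - 8 ^ s < s by lia.
have -> : n + i = 8 ^ s + (n + i - 8 ^ s) by lia.
by apply: ta; rewrite ?sched_burst //; lia.
Qed.

(** At the end of an epoch whose word avoids [a], this letter has occurred only before the epoch and
    in bursts, because class 2 times carry letters of class at most 2. *)
Lemma npos_letter2 a i : ~~ letter 2 a -> ~ positive 2 (fun n => coded (n + i) == a).
Proof.
move=> la [q [N H]]; have [t ta] := burst_word_avoids (isT : 0 < 2) la.
have [M Mb] := burst_sublinear (2 * q) i.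
have [e eN et] := logn2_unbounded t (N + M + i + 2 * q + 2).
pose S := 2 ^ e; have eS : e < S by rewrite ltn_expl.
have S8 : S < 8 ^ S by rewrite ltn_expl.
have S2 : 2 ^ e.+1 = S + S by rewrite expnS /S; lia.
have SS : 8 ^ (S + S) = 8 ^ S * 8 ^ S by rewrite expnD.
(* The epoch of [e] is [[A, A * A)]: all that precedes it is negligible at its end. *)
pose A := 8 ^ S; pose n := A * A - i.
have A8 : e < A by rewrite /A; lia.
have AA : A * e <= A * A by rewrite leq_mul2l (ltnW A8) orbT.
have nb : A * (2 * q) + N + M + i + 1 <= A * A by nia.
have ni : n + i = A * A by rewrite /n; lia.
have := H n; have := Mb n.
set B := count burst _; set C := count _ _ => /(_ _) Bn /(_ _) Cn.
have {}Bn : 2 * q * B < n by apply: Bn; lia.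
have {}Cn : n <= q * C by apply: Cn; lia.
suff CB : C <= A + B.
  have : q * C <= q * (A + B) by rewrite leq_mul2l CB orbT.
  by rewrite mulnDr; lia.
move=> {Bn Cn}; rewrite {}/C {}/B.
rewrite (count_iota_shift (fun k => coded k == a) i) add0n.
have le : i + n <= 0 + (A + (n + i - A)) by lia.
apply: leq_trans (leq_count_iota_sub _ (leq0n i) le) _.
have -> : iota 0 (n + i) = iota 0 (A + (n + i - A)) by congr iota; nia.
rewrite !iotaD !count_cat add0n.
apply: leq_add; first by rewrite (leq_trans (count_size _ _)) // size_iota.
apply: leq_trans (leq_addl _ _).
apply: leq_count_iota => k /andP[Ak kA] /eqP xk.
have {}kA : k < A * A by nia.
have k0 : 0 < k by lia.
apply/negPn/negP => nb_k.
have := ta k k0; rewrite /sched (negbTE nb_k).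
set s := trunc_log 8 k.
have sS : S <= s by apply: trunc_log_max.
have sSS : s < S + S.
  rewrite -(@ltn_exp2l 8) // SS (leq_ltn_trans _ kA) //.
  by have /andP[] := trunc_log_bounds (isT : 1 < 8) k0.
have se : trunc_log 2 s = e by apply: trunc_log_eq => //; rewrite S2 sSS sS.
case: ifP => [/andP[k2 fc]|_]; last by rewrite se et => /(_ erefl isT) /(_ xk).
have a0 : a <> 0 by move=> a0; move: la; rewrite a0 letter0 fc.
move=> _; have := @coded_sched k; rewrite xk => /(_ a0 k0).
by rewrite /sched (negbTE nb_k) -/s k2 fc /= (negbTE la).
Qed.

(** Such a letter is 4, which the schedule admits in bursts only. *)
Lemma npos_letter3 a i : ~~ letter 3 a -> letter 4 a ->
  ~ positive 3 (fun n => coded (n + i) == a).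
Proof.
move=> l3 l4 [q H]; have a4 : a = 4.
  by have := first_class_bounds; move: l3 l4; rewrite /letter; lia.
have [N Nb] := burst_sublinear q i; have [n Nn] := H N.
apply/negP; rewrite -ltnNge (leq_ltn_trans _ (Nb n Nn)) // leq_mul2l; apply/orP; right.
rewrite (count_iota_shift (fun k => coded k == a) i) add0n.
apply: leq_trans (leq_count_iota_sub _ (leq0n i) (_ : i + n <= 0 + (n + i))) _.
  by rewrite addnC.
apply: leq_count_iota => k _ /eqP xk.
have [k0|k0] := posnP k.
  have [a6|a6] := boolP (alpha 6); last by move: xk; rewrite k0 coded0 // a4.
  by move: l3; rewrite -xk k0 coded0_letter.
have := @coded_sched k; rewrite xk a4 => /(_ ltac:(by []) k0).
by case: (sched_class k) => [[_ //]|[-> _]|->]; rewrite /letter /=; lia.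
Qed.

Lemma npos_letter4 a i : ~~ letter 4 a -> letter 5 a ->
  ~ positive 4 (fun n => coded (n + i) == a).
Proof.
move=> l4 l5 P4; have a5 : a = 5.
  by have := first_class_bounds; move: l4 l5; rewrite /letter; lia.
apply: sparse_npos4.
have {}P4 : positive 4 (fun n => sparse (n + i)).
  by apply: pos_sub P4 => n /eqP; rewrite a5 => /coded_sparse.
case: P4 => q H; exists q => N; have [m [n [Nn nq]]] := H N.
by exists (m + i), n; split; rewrite // -count_iota_shift.
Qed.

(** For classes 3 and 4, positivity is passed upwards to the class just below that of [a]; a letter
    outside class 5 never occurs after time 0. *)
Lemma npos_letter c a i : 0 < c <= 5 -> ~~ letter c a ->
  ~ positive c (fun n => coded (n + i) == a).
Proof.
have n5 : ~~ letter 5 a -> ~ positive 5 (fun n => coded (n + i) == a).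
  move=> l5 /(_ 1)[n n0 /eqP xn]; move: l5; rewrite -xn coded_letter5 //.
  by rewrite addn_gt0 n0.
have n4 : ~~ letter 4 a -> ~ positive 4 (fun n => coded (n + i) == a).
  move=> l4 p4; have [l5|/n5] := boolP (letter 5 a); first exact: npos_letter4 p4.
  by apply; apply: posS p4.
have n3 : ~~ letter 3 a -> ~ positive 3 (fun n => coded (n + i) == a).
  move=> l3 p3; have [l4|/n4] := boolP (letter 4 a); first exact: npos_letter3 p3.
  by apply; apply: posS p3.
case: c => [|[|[|[|[|[|c]]]]]] // _.
- exact: npos_letter1.
- exact: npos_letter2.
Qed.

(** From left to right, a single occurrence at some [n > 0] supplies the position [n0], and the
    vanishing densities of letters bound their classes. *)
Lemma pos_occP c z : 0 < c <= 5 ->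
  (forall l, positive c (occ z l)) <-> (forall l, legal c z l).
Proof.
move=> c5; split; last exact: pos_occ.
move=> zP l; have [n n0 /occP xz] := pos_ex c5 (zP l).
exists n => i il; split.
- apply/negPn/negP => /(npos_letter (i := i) c5); apply.
  by apply: pos_sub (zP l) => k /occP /(_ i il) /eqP.
- by rewrite -xz //; apply: coded_masked; rewrite addn_gt0 n0.
- by rewrite -xz //; apply: coded_sparse.
Qed.

End Construction.

(** * Densities and the full shift *)

Import Order.TTheory GRing.Theory Num.Theory.
Local Open Scope classical_set_scope.
Local Open Scope ring_scope.

(** * Positivity of lower and upper limits *)

Section PositiveLimits.
Variables (R : realType) (T : choiceType) (X : filteredType T).
Implicit Types (f : X -> \bar R) (F : set_system X).

Lemma limf_einf_gt0 f F : (0 < limf_einf f F)%E <->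
  exists2 e : R, 0 < e & exists2 V, F V & forall t, V t -> (e%:E <= f t)%E.
Proof.
rewrite limf_einfE; split=> [/ereal_sup_gt[_ [V FV <-]] V0|[e e0 [V FV Ve]]].
  have [e e0 eV] : exists2 e : R, 0 < e & (e%:E <= ereal_inf (f @` V))%E.
    case: (ereal_inf _) V0 => [r|_|//]; first by rewrite lte_fin => r0; exists r.
    by exists 1; rewrite ?leey.
  exists e => //; exists V => // t Vt.
  by apply: le_trans eV _; apply: ereal_inf_lbound; exists t.
apply: (@lt_le_trans _ _ e%:E); first by rewrite lte_fin.
apply: le_trans (ereal_sup_ubound _); last by exists V.
by apply: le_ereal_inf_tmp => _ [t Vt <-]; exact: Ve.
Qed.

Lemma limf_esup_gt0 f F : (0 < limf_esup f F)%E <->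
  exists2 e : R, 0 < e & forall V, F V -> exists2 t, V t & (e%:E <= f t)%E.
Proof.
rewrite limf_esupE; set c := ereal_inf _; split=> [c0|[e e0 He]].
  have [e e0 ec] : exists2 e : R, 0 < e & (e%:E < c)%E.
    case: (c) c0 => [r|_|//]; last by exists 1; rewrite ?ltry.
    (* Halving gives the strict inequality needed to extract a point from a supremum. *)
    rewrite lte_fin => r0; exists (r / 2); first by rewrite divr_gt0.
    by rewrite lte_fin ltr_pdivrMr // ltr_pMr // ltr1n.
  exists e => // V FV.
  have /ereal_sup_gt[_ [t Vt <-] et] : (e%:E < ereal_sup (f @` V))%E.
    by apply: lt_le_trans ec _; apply: ereal_inf_lbound; exists V.
  by exists t => //; exact: ltW.
apply: (@lt_le_trans _ _ e%:E); first by rewrite lte_fin.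
apply: le_ereal_inf_tmp => _ [V /He[t Vt et] <-].
by apply: le_trans et _; apply: ereal_sup_ubound; exists t.
Qed.

End PositiveLimits.

(** * Positive densities in counting form *)

Section Densities.
Variable R : realType.
Implicit Type S : set nat.

Lemma frequency_ge S (e : R) : 0 < e -> exists q, forall I : nat * nat,
  (0 < I.2)%N -> (e%:E <= frequency R S I)%E ->
  (I.2 <= q * count (fun k => k \in S) (iota I.1 I.2))%N.
Proof.
move=> e0; exists (Num.bound e^-1) => -[m n] /= n0.
rewrite /frequency lee_fin /= => en.
have n0' : 0 < n%:R :> R by rewrite ltr0n.
rewrite -(@ler_nat R) natrM; move: en; rewrite ler_pdivlMr // => en.
have qe : e^-1 <= (Num.bound e^-1)%:R.
  by rewrite ltW // archi_boundP // invr_ge0 ltW.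
rewrite -ler_pdivlMl // in en.
by apply: le_trans en _; rewrite ler_wpM2r // ler0n.
Qed.

Lemma frequency_le S (q : nat) : exists2 e : R, 0 < e & forall I : nat * nat,
  (0 < I.2)%N -> (I.2 <= q * count (fun k => k \in S) (iota I.1 I.2))%N ->
  (e%:E <= frequency R S I)%E.
Proof.
exists q.+1%:R^-1 => [|[m n] /= n0 nq]; first by rewrite invr_gt0.
rewrite /frequency lee_fin /= ler_pdivlMr ?ltr0n // ler_pdivrMl ?ltr0n //.
by rewrite -natrM ler_nat mulSn (leq_trans nq) // leq_addl.
Qed.

Definition density (c : nat) : set nat -> \bar R :=
  match c with
  | 1 => @lower_Banach_density R
  | 2 => @lower_density R
  | 3 => @upper_density R
  | _ => @upper_Banach_density R
  end.

Lemma density_gt0 c S : (0 < c <= 4)%N ->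
  (0 < density c S)%E <-> positive c (fun k => k \in S).
Proof.
case: c => [|[|[|[|[|c]]]]] // _ /=.
- rewrite /lower_Banach_density limf_einf_gt0; split.
    move=> [e e0 [V [N _ NV] Ve]]; have [q Hq] := frequency_ge S e0.
    (* [N.+1] keeps out the empty interval, whose frequency is conventional. *)
    exists q, N.+1 => m n Nn; apply: (Hq (m, n)) => /=; first by lia.
    by apply: Ve; apply: NV => /=; lia.
  move=> [q [N H]]; have [e e0 He] := frequency_le S q; exists e => //.
  exists [set I | (N.+1 <= I.2)%N]; first by exists N.+1.
  by move=> [m n] /= Nn; apply: He => /=; [lia|apply: H; lia].
- rewrite /lower_density /limn_einf /limn_esup limf_esupN oppeK limf_einf_gt0; split.
    move=> [e e0 [V [N _ NV] Ve]]; have [q Hq] := frequency_ge S e0.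
    exists q, N.+1 => n Nn; apply: (Hq (0%N, n)) => /=; first by lia.
    by apply: Ve; apply: NV => /=; lia.
  move=> [q [N H]]; have [e e0 He] := frequency_le S q; exists e => //.
  exists [set n | (N.+1 <= n)%N]; first by exists N.+1.
  by move=> n /= Nn; apply: He => /=; [lia|apply: H; lia].
- rewrite /upper_density /limn_esup limf_esup_gt0; split.
    move=> [e e0 He]; have [q Hq] := frequency_ge S e0; exists q => N.
    have [|n /= Nn en] := He [set n | (N.+1 <= n)%N]; first by exists N.+1.
    by exists n; [lia|apply: (Hq (0%N, n)) => //=; lia].
  move=> [q H]; have [e e0 He] := frequency_le S q; exists e => // V [N _ NV].
  have [n Nn nq] := H N.+1; exists n; first by apply: NV => /=; lia.
  by apply: He => //=; lia.
- rewrite /upper_Banach_density limf_esup_gt0; split.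
    move=> [e e0 He]; have [q Hq] := frequency_ge S e0; exists q => N.
    have [|[m n] /= Nn en] := He [set I | (N.+1 <= I.2)%N]; first by exists N.+1.
    by exists m, n; split; [lia|apply: (Hq (m, n)) => //=; lia].
  move=> [q H]; have [e e0 He] := frequency_le S q; exists e => // V [N _ NV].
  have [m [n [Nn nq]]] := H N.+1; exists (m, n); first by apply: NV => /=; lia.
  by apply: He => //=; lia.
Qed.

End Densities.

(** * Metric, compactness and limit sets of the full shift *)

Section FullShift.

Definition full_shift (R : realType) (A : finType) : Type := nat -> A.

HB.instance Definition _ R A := gen_eqMixin (full_shift R A).
HB.instance Definition _ R A := gen_choiceMixin (full_shift R A).

Variables (R : realType) (A : finType).
Implicit Types x y z : full_shift R A.

(** The ultrametric [1 / (m + 1)], with [m] the first place of disagreement. *)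
Definition shift_dist x y : R :=
  if pselect (exists n, x n != y n) is left h then (ex_minn h).+1%:R^-1 else 0.

Lemma shift_dist_le x y n :
  shift_dist x y <= n.+1%:R^-1 <-> forall i, (i < n)%N -> x i = y i.
Proof.
rewrite /shift_dist; case: pselect => [h|h].
  case: ex_minnP => m xym mmin; rewrite lef_pV2 ?posrE ?ltr0n // ler_nat ltnS.
  split=> [nm i im|H].
    apply/eqP/negPn/negP => /mmin; rewrite leqNgt => /negP; apply.
    exact: leq_trans im nm.
  by rewrite leqNgt; apply/negP => /H /eqP; rewrite (negbTE xym).
split=> [_ i _|_]; last by rewrite invr_ge0.
by apply/eqP/negPn/negP => xyi; apply: h; exists i.
Qed.

Lemma shift_distP x y : shift_dist x y = 0 \/
  exists2 m, shift_dist x y = m.+1%:R^-1 & x m <> y m.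
Proof.
rewrite /shift_dist; case: pselect => [h|h]; [right|by left].
by case: ex_minnP => m xym _; exists m => //; apply/eqP.
Qed.

Lemma shift_dist_ge x y m : x m <> y m -> m.+1%:R^-1 <= shift_dist x y.
Proof.
move=> xym; rewrite /shift_dist; case: pselect => [h|[]]; last by exists m; apply/eqP.
case: ex_minnP => k _ kmin; rewrite lef_pV2 ?posrE ?ltr0n // ler_nat ltnS.
by apply: kmin; apply/eqP.
Qed.

Lemma shift_dist_ge0 x y : 0 <= shift_dist x y.
Proof. by case: (shift_distP x y) => [->//|[m -> _]]; rewrite invr_ge0. Qed.

Lemma shift_distxx x : shift_dist x x = 0.
Proof. by case: (shift_distP x x) => [|[m _]]. Qed.

Lemma shift_dist_eq0 x y : shift_dist x y = 0 -> x = y.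
Proof.
move=> xy0; apply/funext => i; apply/eqP/negPn/negP => /eqP /shift_dist_ge.
by rewrite xy0 leNgt invr_gt0 ltr0n.
Qed.

Lemma shift_dist_sym x y : shift_dist x y = shift_dist y x.
Proof.
suff le u v : shift_dist u v <= shift_dist v u by apply/eqP; rewrite eq_le !le.
case: (shift_distP u v) => [->|[m -> uvm]]; first exact: shift_dist_ge0.
by apply: shift_dist_ge; apply: nesym.
Qed.

(** Where [x] and [z] first differ, [y] differs from one of them. *)
Lemma shift_dist_triangle y x z :
  shift_dist x z <= shift_dist x y + shift_dist y z.
Proof.
case: (shift_distP x z) => [->|[m -> xzm]].
  by rewrite addr_ge0 // shift_dist_ge0.
have [xy|/eqP xy] := eqVneq (x m) (y m).
  by rewrite -[leLHS]add0r lerD ?shift_dist_ge0 // shift_dist_ge // -xy.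
by rewrite -[leLHS]addr0 lerD ?shift_dist_ge0 // shift_dist_ge.
Qed.

HB.instance Definition _ := isMetric.Build R (full_shift R A)
  shift_distxx shift_dist_eq0 shift_dist_sym shift_dist_triangle.

Lemma shift_ball x y n :
  ball x (n.+1%:R^-1) y -> forall i, (i < n)%N -> x i = y i.
Proof. by rewrite ballEmdist => /ltW /shift_dist_le. Qed.

Lemma ball_shift x (e : R) : 0 < e -> exists n, forall y,
  (forall i, (i < n)%N -> x i = y i) -> ball x e y.
Proof.
move=> e0; exists (Num.bound e^-1) => y xy.
rewrite ballEmdist /=; have /shift_dist_le := xy; move/le_lt_trans; apply.
rewrite invf_plt ?posrE ?ltr0n // (@lt_le_trans _ _ (Num.bound e^-1)%:R) //.
  by rewrite archi_boundP // invr_ge0 ltW.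
by rewrite ler_nat.
Qed.

Definition shift_map (x : full_shift R A) : full_shift R A := fun n => x n.+1.

Lemma iter_shift n x : iter n shift_map x = fun i => x (n + i)%N.
Proof.
elim: n => [|n IH] //=; rewrite IH; apply/funext => i.
by rewrite /shift_map addnS addSn.
Qed.

Lemma nbhs_shift x (U : set (full_shift R A)) : nbhs x U <->
  exists n, forall y, (forall i, (i < n)%N -> x i = y i) -> U y.
Proof.
split=> [/nbhs_ballP[e e0 eU]|[n nU]].
  by have [n xn] := ball_shift x e0; exists n => y /xn /eU.
by apply/nbhs_ballP; exists n.+1%:R^-1 => [|y /shift_ball /nU//] /=; rewrite invr_gt0.
Qed.

Lemma shift_continuous : continuous shift_map.
Proof.
move=> x U /nbhs_shift[n nU]; apply/nbhs_shift; exists n.+1 => y xy.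
by apply: nU => i il; apply: xy.
Qed.

(** The alphabet being finite, an ultrafilter selects one letter per coordinate and converges to the
    sequence of selected letters. *)
Lemma full_shift_compact : compact [set: full_shift R A].
Proof.
rewrite compact_ultra => F UF _.
have Fx n : exists a, F [set x : full_shift R A | x n = a].
  apply: contrapT => noa.
  have : F (fun x : full_shift R A => forall a, x n <> a).
    apply: filter_forall => a.
    have [Fa|//] := in_ultra_setVsetC [set x : full_shift R A | x n = a] UF.
    by case: noa; exists a.
  by move=> /filter_ex[x /(_ (x n))].
pose y n := projT1 (cid (Fx n)).
have Fy n : F [set x : full_shift R A | x n = y n] by exact: projT2 (cid (Fx n)).
exists y; split=> // U /nbhs_shift[n nU].
suff : F [set x : full_shift R A | forall i, (i < n)%N -> y i = x i].
  by apply: filterS.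
elim: n {nU} => [|n IH]; first by apply: filterS filterT => x _ i.
apply: filterS (filterI IH (Fy n)) => x [xi xn] i; rewrite ltnS leq_eqVlt.
by case/predU1P => [->|/xi].
Qed.

Lemma closure_shift (S : set (full_shift R A)) : closure S =
  [set z | forall n, exists2 y, S y & forall i, (i < n)%N -> y i = z i].
Proof.
apply/seteqP; split=> z zS.
  move=> n; have [|y [Sy zy]] := zS [set y | forall i, (i < n)%N -> z i = y i].
    by apply/nbhs_shift; exists n.
  by exists y => // i /zy.
move=> U /nbhs_shift[n nU]; have [y Sy yz] := zS n; exists y; split=> //.
by apply: nU => i /yz.
Qed.

Definition occurrences x z (l : nat) : pred nat :=
  fun n => [forall i : 'I_l, x (n + i)%N == z i].

Lemma occurrencesP x z l n :
  reflect (forall i, (i < l)%N -> x (n + i)%N = z i) (occurrences x z l n).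
Proof.
apply: (iffP forallP) => [H i il|H i]; first exact: eqP (H (Ordinal il)).
by apply/eqP/H.
Qed.

Lemma omega_limit_shift x : omega_limit shift_map x =
  [set z | forall l, positive 5 (occurrences x z l)].
Proof.
apply/seteqP; split=> z.
  move=> zx l N; have /= := zx N.+1 isT.
  rewrite closure_shift => /(_ l)[_ [k /= Nk ->] xz].
  exists k; first by lia.
  by apply/occurrencesP => i il; have := xz i il; rewrite iter_shift.
move=> zx n /= n1; rewrite closure_shift => l /=.
have [k nk /occurrencesP xk] := zx l n; exists (iter k shift_map x); first by exists k.
by move=> i /xk; rewrite iter_shift.
Qed.

Lemma closure_orb_shift x : closure (orb shift_map x) =
  [set z | forall l, exists n, occurrences x z l n].
Proof.
rewrite closure_shift; apply/seteqP; split=> z zx l.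
  have [_ [n _ <-] xz] := zx l; exists n.
  by apply/occurrencesP => i /xz; rewrite iter_shift.
have [n /occurrencesP xz] := zx l; exists (iter n shift_map x); first by exists n.
by move=> i /xz; rewrite iter_shift.
Qed.

Lemma omega_density_shift c x : (0 < c <= 4)%N ->
  omega_density shift_map (@density R c) x =
  [set z | forall l, positive c (occurrences x z l)].
Proof.
move=> c4; apply/seteqP; split=> z zx.
  move=> l; have := zx l.+1%:R^-1; rewrite invr_gt0 ltr0n => /(_ isT).
  move=> /(density_gt0 _ _ c4); apply: pos_sub => n; rewrite !inE => /shift_ball zn.
  by apply/occurrencesP => i /zn; rewrite iter_shift.
move=> e e0; apply/(density_gt0 _ _ c4); have [l lz] := ball_shift z e0.
apply: pos_sub (zx l) => n /occurrencesP xz; rewrite !inE; apply: lz => i /xz.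
by rewrite iter_shift.
Qed.

End FullShift.

(** * Realization of a code *)

Section Realization.
Variables (R : realType) (alpha : nat -> bool).
Hypothesis alphaP : ~~ [&& alpha 1%N, alpha 2%N & alpha 3%N].

Definition coded_point : full_shift R 'I_7 := fun n => inord (coded alpha n).

(** The condition [0 < c] makes [legal_set 0] empty, like the first term of the chain. *)
Definition legal_set (c : nat) : set (full_shift R 'I_7) :=
  [set z | (0 < c)%N /\ forall l, legal alpha c z l].

Lemma pos_occurrences c (z : full_shift R 'I_7) l :
  positive c (occurrences coded_point z l) <-> positive c (occ alpha z l).
Proof.
have e n : occurrences coded_point z l n = occ alpha z l n.
  apply/occurrencesP/occP => H i /H; rewrite /coded_point.
    by move=> <-; rewrite inordK // ltnS coded_le6.
  by move=> xz; apply/val_inj; rewrite /= inordK ?xz.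
by split; apply: pos_sub => n; rewrite /in_mem /= e.
Qed.

Lemma pos_legal_set c : (0 < c <= 5)%N ->
  [set z | forall l, positive c (occurrences coded_point z l)] = legal_set c.
Proof.
move=> c5; apply/seteqP; split=> z.
  move=> zP; split; first by case/andP: c5.
  by apply/(pos_occP alphaP z c5) => l; apply/pos_occurrences.
by move=> [_ zP] l; apply/pos_occurrences; move: l; apply/(pos_occP alphaP z c5).
Qed.

Lemma omega_chain_coded_point c : (c <= 5)%N ->
  nth set0 (omega_chain (@shift_map R _) coded_point) c = legal_set c.
Proof.
case: c => [|c] c5; first by apply/seteqP; split=> // z [].
rewrite -pos_legal_set //; case: c c5 => [|[|[|[|[|c]]]]] // _.
- exact: (@omega_density_shift _ _ 1).
- exact: (@omega_density_shift _ _ 2).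
- exact: (@omega_density_shift _ _ 3).
- exact: (@omega_density_shift _ _ 4).
- exact: omega_limit_shift.
Qed.

(** For a strict digit, a letter new at class [c] followed by zeros separates the sets; for an
    equality digit, classes [c.-1] and [c] have the same letters. *)
Lemma legal_set_step c : (0 < c <= 5)%N ->
  chain_step (alpha c) (legal_set c.-1) (legal_set c).
Proof.
move=> c5; have le z l : legal alpha c.-1 z l -> legal alpha c z l.
  by apply: legal_sub => a; apply: letter_mono (leq_pred c).
have c0 : (0 < c)%N by case/andP: c5.
have sub : legal_set c.-1 `<=` legal_set c by move=> z [_ zP]; split=> // l; exact/le.
rewrite /chain_step; case: ifPn => [ac|/(letter_refine c5)[a /andP[ca nca]]].
  apply/seteqP; split=> // z [_ zP].
  have zP' l : legal alpha c.-1 z l.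
    by apply: legal_sub (zP l) => a; rewrite (letter_stable alphaP _ c0 ac).
  (* The first letter of [z] forces [first_class <= c.-1], hence [0 < c.-1]. *)
  split=> //; have [n /(_ 0%N isT)[/letter_nonempty h _ _]] := zP' 1%N.
  by apply: leq_trans h; have /andP[] := first_class_bounds alpha.
split=> //; pose z : full_shift R 'I_7 := fun i => inord (if i == 0%N then a else 0%N).
have zE i : z i = (if i == 0%N then a else 0%N) :> nat.
  by rewrite /z inordK //; case: ifP => // _; have := letter_le5 ca; lia.
move=> /(_ z)[|_ /(_ 1%N)[n /(_ 0%N isT)[]]]; last by rewrite zE (negbTE nca).
split=> // l; have [n nP] := legal_single l ca; exists n => i il.
by rewrite zE; exact: nP.
Qed.

(** If digit 6 is strict, the point itself starts with 6, outside class 5; otherwise the words read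
    at time 0 are legal as well. *)
Lemma closure_orb_step :
  chain_step (alpha 6%N) (legal_set 5) (closure (orb (@shift_map R _) coded_point)).
Proof.
have pE i : coded_point i = coded alpha i :> nat by rewrite inordK // ltnS coded_le6.
have sub : legal_set 5 `<=` closure (orb (@shift_map R _) coded_point).
  rewrite -pos_legal_set // closure_orb_shift => z zP l.
  by have [n _ xz] := zP l 0%N; exists n.
rewrite /chain_step; case: ifPn => a6.
  apply/seteqP; split=> // z; rewrite closure_orb_shift => zP; split=> // l.
  have [n /occurrencesP xz] := zP l.
  have na : (0 < n)%N || alpha 6%N by rewrite a6 orbT.
  have [n0 nP] := legal_orbit l na.
  by exists n0 => i il; rewrite -xz // pE; exact: nP.
split=> // /(_ coded_point)[|_ /(_ 1%N)[n /(_ 0%N isT)[]]].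
  by rewrite closure_orb_shift => l; exists 0%N; apply/occurrencesP.
by move=> /letter_le5; rewrite pE coded0.
Qed.

Lemma coded_point_satisfies_case (code : 6.-tuple bool) :
  (forall i : 'I_6, tnth code i = alpha i.+1) ->
  satisfies_case (@shift_map R _) code coded_point.
Proof.
move=> codeE i; rewrite codeE; have [i5|i5] := ltnP i 5.
  by rewrite !omega_chain_coded_point ?(ltnW i5) //; apply: (@legal_set_step i.+1).
have -> : i = 5%N :> nat by have := ltn_ord i; lia.
rewrite omega_chain_coded_point //; exact: closure_orb_step.
Qed.

End Realization.

Lemma realize_code (R : realType) (code : 6.-tuple bool) :
  admissible_codes code -> exists x, satisfies_case (@shift_map R 'I_7) code x.
Proof.
move=> [_ cP]; pose alpha n := nth false code n.-1.
exists (coded_point R alpha); apply: coded_point_satisfies_case => [|i];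
  last by rewrite (tnth_nth false).
apply/negP => /and3P[a1 a2 a3]; apply: cP.
exists (alpha 4%N), (alpha 5%N), (alpha 6%N); apply/val_inj => /=.
move: a1 a2 a3; rewrite /alpha /=; case: code {alpha} => s /= /eqP.
by case: s => [|b1 [|b2 [|b3 [|b4 [|b5 [|b6 [|]]]]]]] //= _ -> -> ->.
Qed.

Theorem theorem2 (R : realType) :
  exists (X : metricType R) (f : X -> X),
    [/\ compact [set: X], continuous f &
      forall a2 a3 a4 b1 b2 b3 b4 b5 : bool,
        admissible_codes [tuple false; a2; a3; a4; false; true] ->
        admissible_codes [tuple b1; b2; b3; b4; b5; false] ->
        (exists x : X,
           satisfies_case f [tuple false; a2; a3; a4; false; true] x) /\
        (exists y : X,
           satisfies_case f [tuple b1; b2; b3; b4; b5; false] y)].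
Proof.
exists (full_shift R 'I_7 : metricType R), (@shift_map R 'I_7); split.
- exact: full_shift_compact.
- exact: shift_continuous.
- by move=> ? ? ? ? ? ? ? ? ? ?; split; exact: realize_code.
Qed.
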